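(* Let $\Bbbk$ be a field, $n\ge 2$ an integer, $q\in\Bbbk$ a primitive $n$-th root of unity, $T_n(q)$ the Taft algebra and $A$ a unital associative $\Bbbk$-algebra. Let $\cdot:T_n(q)\otimes A\to A$ be a linear map, written $h\otimes a\mapsto h\cdot a$, and suppose $g\cdot 1_A\in\{0,1_A\}$. Then $\cdot$ is a partial action of $T_n(q)$ on $A$ if and only if either $\cdot$ is a global action, or the restriction of $\cdot$ to $\Bbbk C_n\otimes A$ (where $\Bbbk C_n=\mathrm{span}\{1,g,\dots,g^{n-1}\}$) is a partial action of the group algebra $\Bbbk C_n$ on $A$ with $g\cdot 1_A=0$ and, for all $0\le i,j<n$ and $a\in A$: (i) $g^ix^j\cdot a=q^{-ij}\sum_{k=0}^{j}(-1)^k q^{-\frac{k(k-1)}{2}}\binom{j}{k}_{q^{-1}}(x\cdot 1_A)^{j-k}(g^{i+k}\cdot a)(x\cdot 1_A)^k$; (ii) $(x\cdot 1_A)^n\in Z(A)$; (iii) $g^i\cdot(x\cdot 1_A)=q^{-i}(g^i\cdot 1_A)(x\cdot 1_A)$.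
   Context: The Taft algebra $T_n(q)$ is the Hopf algebra generated by $g,x$ with relations $g^n=1$, $x^n=0$, $xg=qgx$; it has basis $\{g^ix^j:0\le i,j<n\}$, with $\Delta(g)=g\otimes g$, $\Delta(x)=x\otimes 1+g\otimes x$, $\varepsilon(g)=1$, $\varepsilon(x)=0$, $S(g)=g^{n-1}$, $S(x)=-g^{n-1}x$; exponents of $g$ are read modulo $n$. $Z(A)$ is the center of $A$. For a bialgebra $H$ with $\Delta(h)=h_1\otimes h_2$, a partial action of $H$ on $A$ is a linear map $\cdot:H\otimes A\to A$ with (PA.1) $1_H\cdot a=a$, (PA.2) $h\cdot(ab)=(h_1\cdot a)(h_2\cdot b)$, (PA.3) $h\cdot(k\cdot a)=(h_1\cdot 1_A)(h_2k\cdot a)$ for all $h,k\in H$, $a,b\in A$. A global action is a partial action which additionally satisfies $h\cdot 1_A=\varepsilon(h)1_A$ for all $h$ (i.e. $A$ is an $H$-module algebra). $q$-binomial coefficients: for an invertible scalar $p$ and integers $N\ge0$, $m$: $\binom{0}{0}_p=1$, $\binom{N}{m}_p=0$ if $m>N$ or $m<0$, and for $N\ge1$, $0\le m\le N$, $\binom{N}{m}_p=\binom{N-1}{m-1}_p+p^m\binom{N-1}{m}_p$. *)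

(* Defs.v *)
From HB Require Import structures.
From mathcomp Require Import all_boot all_order all_algebra.
Set Implicit Arguments. Unset Strict Implicit. Unset Printing Implicit Defensive.
Import Order.TTheory GRing.Theory.
Local Open Scope ring_scope.

Fixpoint qbinom (R : pzRingType) (p : R) (N m : nat) : R :=
  match N, m with
  | 0, 0 => 1
  | 0, _.+1 => 0
  | N'.+1, 0 => p ^+ 0 * qbinom p N' 0
  | N'.+1, m'.+1 => qbinom p N' m' + p ^+ m'.+1 * qbinom p N' m'.+1
  end.

(* The Taft algebra T_n(q) as a vector space: an element h is given by its
   coefficients h i j on the basis g^i x^j, 0 <= i, j < n (only the
   coefficients with i, j < n are used). *)
Definition taft (k : fieldType) := nat -> nat -> k.

Definition tbasis (k : fieldType) (i j : nat) : taft k :=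
  fun u v => ((u == i) && (v == j))%:R.

(* multiplication of T_n(q):
   (g^i x^j)(g^k x^l) = q^{jk} g^{(i+k) mod n} x^{j+l}  (= 0 if j+l >= n) *)
Definition tmul (k : fieldType) (n : nat) (q : k) (h h' : taft k) : taft k :=
  fun u v => \sum_(i < n) \sum_(j < n) \sum_(i' < n) \sum_(j' < n)
     if (((i + i') %% n)%N == u) && ((j + j')%N == v)
     then h i j * h' i' j' * q ^+ (j * i')%N else 0.

Definition teps (k : fieldType) (n : nat) (h : taft k) : k :=
  \sum_(i < n) h i 0.

(* A linear map T_n(q) (x) A -> A is determined by the linear maps
   act i j = (g^i x^j) . _ : A -> A; its value on h (x) a is: *)
Definition tact (k : fieldType) (A : algType k) (n : nat)
  (act : nat -> nat -> A -> A) (h : taft k) (a : A) : A :=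
  \sum_(i < n) \sum_(j < n) h i j *: act i j a.

(* Partial action of T_n(q) on A.  Comultiplication:
   Delta(g^i x^j) = sum_{m=0}^{j} [j choose m]_q g^{(i+m) mod n} x^{j-m} (x) g^i x^m,
   which is (g^i (x) g^i)(x (x) 1 + g (x) x)^j expanded. *)
Definition is_partial_action (k : fieldType) (A : algType k) (n : nat) (q : k)
  (act : nat -> nat -> A -> A) : Prop :=
  [/\ (* PA.1 *) forall a, tact n act (tbasis k 0 0) a = a,
      (* PA.2 *) forall (h : taft k) (a b : A),
        tact n act h (a * b) =
        \sum_(i < n) \sum_(j < n) \sum_(m < j.+1)
          (h i j * qbinom q j m) *:
            (act ((i + m) %% n)%N (j - m)%N a * act i m b) &
      (* PA.3 *) forall (h h' : taft k) (a : A),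
        tact n act h (tact n act h' a) =
        \sum_(i < n) \sum_(j < n) \sum_(m < j.+1)
          (h i j * qbinom q j m) *:
            (act ((i + m) %% n)%N (j - m)%N 1 *
             tact n act (tmul n q (tbasis k i m) h') a)].

Definition is_global_action (k : fieldType) (A : algType k) (n : nat) (q : k)
  (act : nat -> nat -> A -> A) : Prop :=
  is_partial_action n q act /\
  forall h : taft k, tact n act h 1 = teps n h *: 1.

(* Restriction to the group algebra kC_n = span{g^i}: an element is given by
   coefficients c i (0 <= i < n), acting by g^i . _ = act i 0.
   Partial action of kC_n (Delta(g^i) = g^i (x) g^i, g^i g^l = g^{(i+l) mod n}). *)
Definition gact (k : fieldType) (A : algType k) (n : nat)
  (act : nat -> nat -> A -> A) (c : nat -> k) (a : A) : A :=
  \sum_(i < n) c i *: act i 0%N a.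

Definition gmul (k : fieldType) (n : nat) (c c' : nat -> k) : nat -> k :=
  fun u => \sum_(i < n) \sum_(l < n) if ((i + l) %% n)%N == u then c i * c' l else 0.

Definition gbasis (k : fieldType) (i : nat) : nat -> k := fun u => (u == i)%:R.

Definition is_partial_action_group (k : fieldType) (A : algType k) (n : nat)
  (act : nat -> nat -> A -> A) : Prop :=
  [/\ (* PA.1 *) forall a, gact n act (gbasis k 0) a = a,
      (* PA.2 *) forall (c : nat -> k) (a b : A),
        gact n act c (a * b) = \sum_(i < n) c i *: (act i 0%N a * act i 0%N b) &
      (* PA.3 *) forall (c c' : nat -> k) (a : A),
        gact n act c (gact n act c' a) =
        \sum_(i < n) c i *: (act i 0%N 1 * gact n act (gmul n (gbasis k i) c') a)].

(* Main.v *)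
Require Import Defs.
From HB Require Import structures.
From mathcomp Require Import all_boot all_order all_algebra.
From mathcomp Require Import ring zify.

(* Write X = x.1.  If g.1 = 1, (PA.3) forces g^i.1 = 1 and x.1 = 0, so the
   action is global.  If g.1 = 0, then g^(n-1).1 = 0 as well, and (PA.2), (PA.3)
   for g^(n-1) x give the skew recursion  xh.a = X (h.a) - (gh.a) X.  Its solution
   is formula (i), and at x^n = 0, where all inner q-binomial coefficients vanish,
   it reads X^n a = a X^n.  Conversely, if two families D1, D2 obey the recursion,
   so does h |-> D1(h_1) D2(h_2); hence (PA.2) and (PA.3) for g^i x^j follow by
   uniqueness from the case j = 0. *)

Set Implicit Arguments. Unset Strict Implicit. Unset Printing Implicit Defensive.
Import GRing.Theory.
Local Open Scope ring_scope.

(** * Gaussian binomial coefficients and their values at roots of unity *)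

Lemma qbinom0r (R : pzRingType) (p : R) N : qbinom p N 0 = 1.
Proof. by elim: N => //= N ->; rewrite expr0 mulr1. Qed.

Lemma qbinomS (R : pzRingType) (p : R) N m :
  qbinom p N.+1 m.+1 = qbinom p N m + p ^+ m.+1 * qbinom p N m.+1.
Proof. by []. Qed.

Lemma qbinom_small (R : pzRingType) (p : R) N m : (N < m)%N -> qbinom p N m = 0.
Proof.
elim: N m => [|N IH] [|m] //= lt_Nm.
by rewrite !IH ?mulr0 ?addr0 // ltnW.
Qed.

Lemma qbinomnn (R : pzRingType) (p : R) N : qbinom p N N = 1.
Proof. by elim: N => //= N ->; rewrite qbinom_small // mulr0 addr0. Qed.

Local Arguments qbinom : simpl never.

(** The q-Pascal rule mirrored under the symmetry of the row. Expanding both sides down to row [N]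
    by the two rules leaves a polynomial identity. *)
Lemma qbinomS_dual (R : comPzRingType) (p : R) N m : (m <= N)%N ->
  qbinom p N.+1 m.+1 = qbinom p N m.+1 + p ^+ (N - m) * qbinom p N m.
Proof.
elim: N m => [|N IH] m le_mN.
  by case: m le_mN => // _; rewrite /qbinom !mulr0 addr0 add0r expr0 mulr1.
have [->|ne] := eqVneq m N.+1.
  by rewrite subnn expr0 mul1r !qbinomnn qbinom_small // add0r.
have {ne} lt_mN : (m <= N)%N by rewrite -ltnS ltn_neqAle ne.
rewrite qbinomS [in LHS]IH // [qbinom p N.+1 m.+1 in RHS]qbinomS subSn //.
case: m lt_mN {le_mN} => [|m] lt_mN.
  by rewrite !qbinom0r subn0 (exprS p N); ring.
rewrite [in LHS]IH; last exact: ltnW.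
rewrite [in RHS]qbinomS -(subnSK lt_mN) !exprS; ring.
Qed.

(** Subtract [p ^+ m.+1] times the mirrored Pascal rule from the defining one: the terms in
    [qbinom p N m.+1] cancel. *)
Lemma qbinom_absorb (R : comPzRingType) (p : R) N m : (m <= N)%N ->
  (1 - p ^+ m.+1) * qbinom p N.+1 m.+1 = (1 - p ^+ N.+1) * qbinom p N m.
Proof.
move=> le_mN; rewrite mulrBl mul1r {1}qbinomS (qbinomS_dual p le_mN).
have -> : p ^+ N.+1 = p ^+ m.+1 * p ^+ (N - m) by rewrite -exprD addSn subnKC.
ring.
Qed.

(** In the absorption identity at row [n] the right side carries [1 - p ^+ n = 0], while the left
    factor [1 - p ^+ m] is nonzero for [0 < m < n]. *)
Lemma qbinom_prim_eq0 (F : fieldType) (p : F) n m :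
  n.-primitive_root p -> (0 < m < n)%N -> qbinom p n m = 0.
Proof.
case: n m => [|n] [|m] //= prim_p; rewrite ltnS => lt_mn.
have := qbinom_absorb p (ltnW lt_mn); rewrite (prim_expr_order prim_p) subrr mul0r.
move/eqP; rewrite mulf_eq0 => /orP[|/eqP//].
rewrite subr_eq0 eq_sym -(prim_order_dvd prim_p) => /(dvdn_leq (ltn0Sn m)).
by rewrite ltnS leqNgt lt_mn.
Qed.

(** With [p = q^-1] this is the last coefficient of formula (i) at [x^n]. For [n = 2h + 1] the
    exponent is [n * h]; for [n = 2h] it is [h * (n - 1)] with [n - 1] odd, and [p ^+ h] is a square
    root of 1 other than 1. *)
Lemma prim_root_sign (F : fieldType) (p : F) n : (1 < n)%N ->
  n.-primitive_root p -> (-1) ^+ n * p ^+ (n * (n - 1) %/ 2) = -1.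
Proof.
move=> n_gt1 prim_p; have pn := prim_expr_order prim_p.
have [h [def_n|def_n]] : exists h, n = h.*2.+1 \/ n = h.*2.
- by exists n./2; case: (boolP (odd n)) => on; [left|right]; lia.
- have -> : (n * (n - 1) %/ 2 = n * h)%N by rewrite def_n; nia.
  by rewrite exprM pn expr1n mulr1 -signr_odd def_n /= odd_double.
have -> : (n * (n - 1) %/ 2 = h * (n - 1))%N by rewrite def_n; nia.
have ph : p ^+ h = -1.
  have /eqP : p ^+ h ^+ 2 = 1 by rewrite -exprM muln2 -def_n.
  rewrite sqrf_eq1 -(prim_order_dvd prim_p) => /orP[/dvdn_leq|/eqP//].
  lia.
rewrite exprM ph -signr_odd -[(-1) ^+ (n - 1)]signr_odd.
have -> : odd n = false by rewrite def_n odd_double.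
have -> : odd (n - 1) = true by lia.
by rewrite mul1r.
Qed.

(** * The skew recursion, its products and its closed form *)

(* [D i j] stands for [g^i x^j . a]; since [x g^i = q^i g^i x], this is the
   recursion [xh.a = X (h.a) - (gh.a) X] for [h = g^i x^j]. *)
Definition skew_rec (k : fieldType) (A : algType k) (q : k) (X : A)
  (D : nat -> nat -> A) : Prop :=
  forall i j, D i j.+1 = q ^- i *: (X * D i j - D i.+1 j * X).

(** Pascal's rule as a reindexing: term [m] of row [j] feeds positions [m] and [m.+1] of the next
    row. *)
Lemma sum_qbinomS (k : fieldType) (V : lmodType k) (p : k) (F : nat -> V) j :
  \sum_(m < j.+2) qbinom p j.+1 m *: F m =
  \sum_(m < j.+1) qbinom p j m *: (F m.+1 + p ^+ m *: F m).
Proof.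
under [RHS]eq_bigr do rewrite scalerDr scalerA mulrC.
rewrite big_split /= big_ord_recl qbinom0r.
under [in LHS]eq_bigr do rewrite lift0 qbinomS scalerDl.
rewrite big_split /= addrCA; congr (_ + _).
rewrite [RHS]big_ord_recl expr0 mul1r qbinom0r; congr (_ + _).
by rewrite big_ord_recr /= qbinom_small // mulr0 scale0r addr0.
Qed.

(** The sum is [D1(h_1) D2(h_2)] for [h = g^i x^j]. The coproduct of [xh] is
    [x h_1 ⊗ h_2 + g h_1 ⊗ x h_2]; after both recursions are applied, the mixed terms
    [D1(g h_1) X D2(h_2)] cancel and the recursion for the product remains. *)
Lemma skew_rec_mul (k : fieldType) (A : algType k) (q : k) (X : A)
  (D D1 D2 : nat -> nat -> A) : q != 0 ->
  skew_rec q X D -> skew_rec q X D1 -> skew_rec q X D2 ->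
  (forall i, D i 0%N = D1 i 0%N * D2 i 0%N) ->
  forall i j, D i j = \sum_(m < j.+1) qbinom q j m *: (D1 (i + m)%N (j - m)%N * D2 i m).
Proof.
move=> q0 HD HD1 HD2 D0 i j; elim: j i => [|j IH] i.
  by rewrite D0 big_ord1 addn0 scale1r.
rewrite (sum_qbinomS _ (fun m => D1 (i + m)%N (j.+1 - m)%N * D2 i m)).
rewrite HD !IH mulr_sumr mulr_suml -sumrB scaler_sumr.
apply: eq_bigr => m _.
rewrite -scalerAr -scalerAl -scalerBr scalerA mulrC -scalerA; congr (_ *: _).
have le_mj : (m <= j)%N by rewrite -ltnS ltn_ord.
rewrite subSS subSn // HD1 HD2 addSn addnS.
rewrite -scalerAl -scalerAr scalerA.
(* The weight [q ^+ m] from Pascal's rule compensates the shift [i + m] in [D1], so both summands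
   share the scalar [q ^- i]. *)
have -> : q ^+ m / q ^+ (i + m) = q ^- i.
  by rewrite exprD; field; rewrite !expf_neq0.
rewrite -scalerDr; congr (_ *: _).
by rewrite mulrBl mulrBr !mulrA [RHS]addrC addrA subrK.
Qed.

(** By Gauss's binomial formula this is the coefficient of [t^m] in the product of the factors
    [1 - q^(-l) t] over [l < j]. *)
Definition taft_coef (k : fieldType) (q : k) (j m : nat) : k :=
  (-1) ^+ m * q ^- (m * (m - 1) %/ 2) * qbinom q^-1 j m.

Lemma taft_coef0 (k : fieldType) (q : k) j : taft_coef q j 0 = 1.
Proof. by rewrite /taft_coef qbinom0r mul0n div0n !expr0 invr1 !mulr1. Qed.

Lemma taft_coef_small (k : fieldType) (q : k) j m : (j < m)%N -> taft_coef q j m = 0.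
Proof. by move=> lt_jm; rewrite /taft_coef qbinom_small // mulr0. Qed.

(** Passing from [j] to [j.+1] multiplies the generating product by [1 - q^(-j) t]. *)
Lemma taft_coefS (k : fieldType) (q : k) j m : (m <= j)%N ->
  taft_coef q j.+1 m.+1 = taft_coef q j m.+1 - q ^- j * taft_coef q j m.
Proof.
move=> le_mj; rewrite /taft_coef qbinomS_dual //.
have -> : (m.+1 * (m.+1 - 1) %/ 2 = m * (m - 1) %/ 2 + m)%N.
  have -> : (m.+1 * (m.+1 - 1) = m * 2 + m * (m - 1))%N
    by case: (m) => // l; rewrite !subn1 /=; nia.
  by rewrite divnMDl // addnC.
have -> : q ^- j = q^-1 ^+ (j - m) * q^-1 ^+ m by rewrite -exprD subnK // exprVn.
rewrite -!exprVn exprD exprS; ring.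
Qed.

Definition taft_formula (k : fieldType) (A : algType k) (q : k) (X : A)
  (E : nat -> A) (i j : nat) : A :=
  q ^- (i * j) *:
    \sum_(m < j.+1) taft_coef q j m *: (X ^+ (j - m) * E (i + m)%N * X ^+ m).

Lemma taft_formula0 (k : fieldType) (A : algType k) (q : k) (X : A) E i :
  taft_formula q X E i 0 = E i.
Proof.
by rewrite /taft_formula big_ord1 muln0 addn0 invr1 !scale1r taft_coef0 scale1r mul1r mulr1.
Qed.

(** [taft_coefS] splits the sum at [j.+1] into [X] times the sum at [i], minus [q ^- j] times the
    sum at [i.+1] times [X]. This [q ^- j] is the quotient of the prefactors at [i.+1] and [i]. *)
Lemma taft_formula_skew (k : fieldType) (A : algType k) (q : k) (X : A) E :
  q != 0 -> skew_rec q X (taft_formula q X E).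
Proof.
move=> q0 i j; rewrite /taft_formula -scalerAr -scalerAl.
have -> : q ^- (i.+1 * j) = q ^- (i * j) * q ^- j by rewrite mulSn addnC exprD invfM.
rewrite -scalerA -scalerBr scalerA mulnS exprD invfM; congr (_ *: _).
rewrite big_ord_recl [in RHS]big_ord_recl mulrDr !taft_coef0 !scale1r !subn0 addn0.
rewrite !mulr1 mulrA -exprS -addrA; congr (_ + _).
under eq_bigr => m _.
  rewrite lift0 taft_coefS; last by rewrite -ltnS.
  rewrite scalerBl -(scalerA (q ^- j)).
  over.
rewrite sumrB -scaler_sumr; congr (_ - _ *: _).
  rewrite big_ord_recr /= taft_coef_small // scale0r addr0 mulr_sumr.
  apply: eq_bigr => m _; rewrite /bump add1n -scalerAr; congr (_ *: _).
  by rewrite !mulrA -exprS subSS -[in RHS]subSn // subSS.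
rewrite mulr_suml; apply: eq_bigr => m _.
by rewrite -scalerAl subSS -!mulrA -exprSr addSn addnS.
Qed.

Lemma skew_rec_uniq (k : fieldType) (A : algType k) (q : k) (X : A) (D D' : nat -> nat -> A) :
  skew_rec q X D -> skew_rec q X D' -> (forall i, D i 0%N = D' i 0%N) ->
  forall i j, D i j = D' i j.
Proof. by move=> HD HD' D0 i j; elim: j i => // j IH i; rewrite HD HD' !IH. Qed.

Lemma skew_rec_formula (k : fieldType) (A : algType k) (q : k) (X : A) (D : nat -> nat -> A) :
  q != 0 -> skew_rec q X D ->
  forall i j, D i j = taft_formula q X (D^~ 0%N) i j.
Proof.
move=> q0 HD; apply: skew_rec_uniq HD (taft_formula_skew _ _ q0) _ => i.
by rewrite taft_formula0.
Qed.

(** [q^-1] is [q ^+ n.-1], and [n.-1] is coprime to [n]. *)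
Lemma prim_root_inv (F : fieldType) (q : F) n :
  n.-primitive_root q -> n.-primitive_root q^-1.
Proof.
move=> prim_q; have n_gt0 := prim_order_gt0 prim_q.
have -> : q^-1 = q ^+ n.-1.
  by rewrite -(mul1r q^-1) -(prim_expr_order prim_q) -{1}(prednK n_gt0) exprSr
             mulfK // (prim_root_eq0 prim_q) -lt0n.
by rewrite prim_root_exp_coprime // -{2}(prednK n_gt0) coprimenS.
Qed.

(** The prefactor is 1 and all inner coefficients vanish. Of the two end terms, the last has
    coefficient -1 by [prim_root_sign]. *)
Lemma taft_formula_prim (k : fieldType) (A : algType k) (q : k) (X : A) E i n :
  (1 < n)%N -> n.-primitive_root q ->
  taft_formula q X E i n = X ^+ n * E i - E (i + n)%N * X ^+ n.
Proof.
move=> n_gt1 prim_q; have prim_p : n.-primitive_root q^-1 by apply: prim_root_inv.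
rewrite /taft_formula mulnC exprM (prim_expr_order prim_q) expr1n invr1 scale1r.
case: n n_gt1 prim_q prim_p => // n n_gt1 prim_q prim_p.
rewrite big_ord_recl big_ord_recr big1 /=; last first.
  move=> m _; rewrite /taft_coef qbinom_prim_eq0 ?mulr0 ?scale0r //.
  by rewrite /bump /= add1n ltnS.
rewrite add0r taft_coef0 scale1r addn0 mulr1 subn0; congr (_ + _).
rewrite /taft_coef qbinomnn mulr1 -exprVn prim_root_sign //.
by rewrite /bump /= add1n subnn mul1r scaleN1r.
Qed.

(** * Coordinates: the axioms tested on basis elements *)

Lemma linear_sum2 (k : fieldType) (U V : lmodType k) (f : U -> V) n p
  (c : nat -> nat -> k) (a : nat -> nat -> U) : linear f ->
  f (\sum_(i < n) \sum_(j < p) c i j *: a i j) =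
  \sum_(i < n) \sum_(j < p) c i j *: f (a i j).
Proof.
move=> f_lin; pose f_mixin := GRing.isLinear.Build k U V *:%R f f_lin.
pose fL : {linear U -> V} := HB.pack f f_mixin.
have : fL (\sum_(i < n) \sum_(j < p) c i j *: a i j) =
       \sum_(i < n) \sum_(j < p) c i j *: fL (a i j).
  rewrite linear_sum; apply: eq_bigr => i _; rewrite linear_sum.
  by apply: eq_bigr => j _; rewrite linearZ.
by [].
Qed.

Lemma linear_at0 (k : fieldType) (U V : lmodType k) (f : U -> V) : linear f -> f 0 = 0.
Proof. by move=> f_lin; have := f_lin (-1) 0 0; rewrite addr0 scaler0 scaleN1r addNr. Qed.

Lemma sum_delta (V : nmodType) (n i : nat) (F : nat -> V) :
  \sum_(u < n) (if i == u then F u else 0) = if (i < n)%N then F i else 0.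
Proof.
rewrite -big_mkcond -(big_ord1_eq +%R F i n).
by apply: eq_bigl => u; rewrite eq_sym.
Qed.

Lemma sum_delta2 (V : nmodType) (n i j : nat) (F : nat -> nat -> V) :
  \sum_(u < n) \sum_(v < n) (if (i == u) && (j == v) then F u v else 0) =
  if (i < n)%N && (j < n)%N then F i j else 0.
Proof.
rewrite (eq_bigr (fun u : 'I_n => if i == u then (if (j < n)%N then F u j else 0) else 0)).
  by rewrite (sum_delta n i (fun u => if (j < n)%N then F u j else 0)) -if_and.
move=> u _; rewrite -(sum_delta n j (F u)).
by case: (i == u) => //=; rewrite big1.
Qed.

Lemma sum_tbasis (k : fieldType) (V : lmodType k) n i j (F : nat -> nat -> V) :
  (i < n)%N -> (j < n)%N ->
  \sum_(u < n) \sum_(v < n) tbasis k i j u v *: F u v = F i j.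
Proof.
move=> lt_in lt_jn; have := sum_delta2 n i j F; rewrite lt_in lt_jn /= => <-.
apply: eq_bigr => u _; apply: eq_bigr => v _.
by rewrite /tbasis eq_sym [_ == j]eq_sym; case: ifP; rewrite (scale1r, scale0r).
Qed.

Lemma tact_tbasis (k : fieldType) (A : algType k) n (act : nat -> nat -> A -> A) i j a :
  (i < n)%N -> (j < n)%N -> tact n act (tbasis k i j) a = act i j a.
Proof. exact: sum_tbasis (fun u v => act u v a). Qed.

(* The action of [g^i x^j] for arbitrary exponents: [g^n = 1] and [x^n = 0]. *)
Definition taft_ext (k : fieldType) (A : algType k) (n : nat)
  (act : nat -> nat -> A -> A) (i j : nat) (a : A) : A :=
  if (j < n)%N then act (i %% n)%N j a else 0.

(** For fixed [i'], [j'] at most one pair [u], [v] contributes. As [v] stays below [n], the products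
    with [n <= m + j'] drop out, in agreement with the value 0 of [taft_ext] there. *)
Lemma tact_tmul (k : fieldType) (A : algType k) n (q : k)
  (act : nat -> nat -> A -> A) (h : taft k) i m a : (i < n)%N -> (m < n)%N ->
  tact n act (tmul n q (tbasis k i m) h) a =
  \sum_(i' < n) \sum_(j' < n)
     h i' j' *: (q ^+ (m * i') *: taft_ext n act (i + i') (m + j') a).
Proof.
move=> lt_in lt_mn; have n_gt0 : (0 < n)%N by case: n lt_in {lt_mn}.
pose G i' j' u v := if (((i + i') %% n)%N == u) && ((m + j')%N == v)
  then h i' j' * q ^+ (m * i') else 0.
have tmulE u v : tmul n q (tbasis k i m) h u v = \sum_(i' < n) \sum_(j' < n) G i' j' u v.
  (* Scalars are viewed in the regular module [k^o] so that [sum_tbasis] applies to them. *)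
  pose F i1 j1 : k^o := \sum_(i' < n) \sum_(j' < n)
    if (((i1 + i') %% n)%N == u) && ((j1 + j')%N == v)
    then h i' j' * q ^+ (j1 * i') else 0.
  rewrite -[RHS](sum_tbasis F lt_in lt_mn); apply: eq_bigr => i1 _; apply: eq_bigr => j1 _.
  rewrite scaler_sumr; apply: eq_bigr => i' _; rewrite scaler_sumr; apply: eq_bigr => j' _.
  by case: ifP => _; rewrite ?scaler0 // -mulrA.
rewrite /tact.
under eq_bigr => u _ do under eq_bigr => v _ do rewrite tmulE scaler_suml.
under eq_bigr => u _ do rewrite exchange_big /=.
rewrite exchange_big /=; apply: eq_bigr => i' _.
under eq_bigr => u _ do under eq_bigr => v _ do rewrite scaler_suml.
under eq_bigr => u _ do rewrite exchange_big /=.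
rewrite exchange_big /=; apply: eq_bigr => j' _.
pose F u v := (h i' j' * q ^+ (m * i')) *: act u v a.
transitivity (\sum_(u < n) \sum_(v < n)
  (if (((i + i') %% n)%N == u) && ((m + j')%N == v) then F u v else 0)).
  apply: eq_bigr => u _; apply: eq_bigr => v _.
  by rewrite /G; case: ifP => _; rewrite ?scale0r.
rewrite sum_delta2 ltn_pmod //= /taft_ext /F.
by case: ifP => _; rewrite ?scaler0 // scalerA.
Qed.

(** (PA.2) and (PA.3) are linear in [h] and [h']: evaluating at [tbasis] gives one direction,
    expanding in coordinates the other. *)
Lemma partial_actionP (k : fieldType) (A : algType k) n (q : k)
  (act : nat -> nat -> A -> A) : (0 < n)%N -> (forall i j, linear (act i j)) ->
  is_partial_action n q act <->
  [/\ forall a, act 0%N 0%N a = a,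
      forall i j a b, (i < n)%N -> (j < n)%N ->
        act i j (a * b) = \sum_(m < j.+1) qbinom q j m *:
          (act ((i + m) %% n)%N (j - m)%N a * act i m b) &
      forall i j i' j' a, (i < n)%N -> (j < n)%N -> (i' < n)%N -> (j' < n)%N ->
        act i j (act i' j' a) = \sum_(m < j.+1) qbinom q j m *:
          (act ((i + m) %% n)%N (j - m)%N 1 *
           (q ^+ (m * i') *: taft_ext n act (i + i') (m + j') a))].
Proof.
move=> n_gt0 act_lin; split=> [[pa1 pa2 pa3]|[pa1 pa2 pa3]]; split.
- by move=> a; rewrite -[RHS]pa1 tact_tbasis.
- move=> i j a b lt_in lt_jn; rewrite -(tact_tbasis act _ lt_in lt_jn) pa2.
  pose F i j := \sum_(m < j.+1) qbinom q j m *: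
    (act ((i + m) %% n)%N (j - m)%N a * act i m b).
  rewrite -[RHS](sum_tbasis F lt_in lt_jn).
  apply: eq_bigr => u _; apply: eq_bigr => v _; rewrite scaler_sumr.
  by apply: eq_bigr => m _; rewrite scalerA.
- move=> i j i' j' a lt_in lt_jn lt_in' lt_jn'.
  rewrite -(tact_tbasis act a lt_in' lt_jn') -(tact_tbasis act _ lt_in lt_jn) pa3.
  pose F i j := \sum_(m < j.+1) qbinom q j m *:
    (act ((i + m) %% n)%N (j - m)%N 1 *
     (q ^+ (m * i') *: taft_ext n act (i + i') (m + j') a)).
  rewrite -[RHS](sum_tbasis F lt_in lt_jn).
  apply: eq_bigr => u _; apply: eq_bigr => v _; rewrite scaler_sumr.
  apply: eq_bigr => m _; rewrite scalerA tact_tmul ?(leq_trans (ltn_ord m)) //.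
  by rewrite (sum_tbasis (fun i' j' => q ^+ (m * i') *: taft_ext n act (u + i') (m + j') a)).
- by move=> a; rewrite tact_tbasis.
- move=> h a b; apply: eq_bigr => i _; apply: eq_bigr => j _.
  rewrite pa2 // scaler_sumr.
  by apply: eq_bigr => m _; rewrite scalerA.
- move=> h h' a; apply: eq_bigr => i _; apply: eq_bigr => j _.
  rewrite [tact n act h' a]/tact (linear_sum2 _ _ h' (fun i' j' => act i' j' a)) //.
  rewrite scaler_sumr.
  under [LHS]eq_bigr => i' _ do rewrite scaler_sumr.
  under [RHS]eq_bigr => m _.
    rewrite tact_tmul ?(leq_trans (ltn_ord m)) // mulr_sumr scaler_sumr.
    under eq_bigr => i' _ do rewrite mulr_sumr scaler_sumr.
    over.
  rewrite [RHS]exchange_big /=; apply: eq_bigr => i' _.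
  rewrite [RHS]exchange_big /=; apply: eq_bigr => j' _.
  rewrite pa3 // !scaler_sumr; apply: eq_bigr => m _.
  by rewrite -!scalerAr !scalerA; congr (_ *: _); ring.
Qed.

Lemma partial_action_groupP (k : fieldType) (A : algType k) n
  (act : nat -> nat -> A -> A) : (0 < n)%N -> (forall i, linear (act i 0%N)) ->
  is_partial_action_group n act <->
  [/\ forall a, act 0%N 0%N a = a,
      forall i a b, (i < n)%N -> act i 0%N (a * b) = act i 0%N a * act i 0%N b &
      forall i l a, (i < n)%N -> (l < n)%N ->
        act i 0%N (act l 0%N a) = act i 0%N 1 * act ((i + l) %% n)%N 0%N a].
Proof.
move=> n_gt0 act_lin.
have sum_gbasis (V : lmodType k) i (F : nat -> V) : (i < n)%N ->
  \sum_(u < n) gbasis k i u *: F u = F i.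
  move=> lt_in; have := sum_delta n i F; rewrite lt_in => <-; apply: eq_bigr => u _.
  by rewrite /gbasis eq_sym; case: ifP; rewrite (scale1r, scale0r).
have gact_gbasis i a : (i < n)%N -> gact n act (gbasis k i) a = act i 0%N a.
  exact: sum_gbasis (fun u => act u 0%N a).
have gact_gmul i c a : (i < n)%N ->
  gact n act (gmul n (gbasis k i) c) a = \sum_(l < n) c l *: act ((i + l) %% n)%N 0%N a.
  move=> lt_in; rewrite /gact.
  have gmulE u : gmul n (gbasis k i) c u =
      \sum_(l < n) if ((i + l) %% n)%N == u then c l else 0.
    pose F i1 : k^o := \sum_(l < n) if ((i1 + l) %% n)%N == u then c l else 0.
    rewrite -[RHS](sum_gbasis _ _ F lt_in); apply: eq_bigr => i1 _.
    by rewrite scaler_sumr; apply: eq_bigr => l _; case: ifP; rewrite ?scaler0.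
  under eq_bigr => u _ do rewrite gmulE scaler_suml.
  rewrite exchange_big /=; apply: eq_bigr => l _.
  have := sum_delta n ((i + l) %% n) (fun u => c l *: act u 0%N a).
  rewrite ltn_pmod // => <-; apply: eq_bigr => u _.
  by case: ifP; rewrite ?scale0r.
split=> [[pa1 pa2 pa3]|[pa1 pa2 pa3]]; split.
- by move=> a; rewrite -[RHS]pa1 gact_gbasis.
- move=> i a b lt_in; rewrite -gact_gbasis // pa2.
  exact: sum_gbasis (fun i => act i 0%N a * act i 0%N b) lt_in.
- move=> i l a lt_in lt_ln; rewrite -[act l 0%N a]gact_gbasis // -gact_gbasis // pa3.
  rewrite (sum_gbasis _ _
    (fun i => act i 0%N 1 * gact n act (gmul n (gbasis k i) (gbasis k l)) a)) //.
  by rewrite gact_gmul // (sum_gbasis _ _ (fun l => act ((i + l) %% n)%N 0%N a)).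
- by move=> a; rewrite gact_gbasis.
- by move=> c a b; apply: eq_bigr => i _; rewrite pa2.
- move=> c c' a; apply: eq_bigr => i _; congr (_ *: _); rewrite gact_gmul //.
  (* An inner sum of length one turns the double sum into a single one. *)
  have := linear_sum2 n 1 (fun l _ => c' l) (fun l _ => act l 0%N a) (act_lin i).
  under eq_bigr do rewrite big_ord1.
  under [RHS]eq_bigr do rewrite big_ord1.
  move=> ->; rewrite mulr_sumr; apply: eq_bigr => l _.
  by rewrite pa3 // scalerAr.
Qed.

(** * Consequences of the axioms in the cases [g.1 = 1] and [g.1 = 0] *)

Lemma taft_ext_small (k : fieldType) (A : algType k) n (act : nat -> nat -> A -> A) i j a :
  (i < n)%N -> (j < n)%N -> taft_ext n act i j a = act i j a.
Proof. by move=> lt_in lt_jn; rewrite /taft_ext lt_jn modn_small. Qed.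

Lemma taft_ext_mod (k : fieldType) (A : algType k) n (act : nat -> nat -> A -> A) i j a :
  taft_ext n act (i %% n)%N j a = taft_ext n act i j a.
Proof. by rewrite /taft_ext modn_mod. Qed.

Lemma taft_extDl (k : fieldType) (A : algType k) n (act : nat -> nat -> A -> A) i j a :
  taft_ext n act (n + i)%N j a = taft_ext n act i j a.
Proof. by rewrite /taft_ext modnDl. Qed.

Lemma taft_ext_large (k : fieldType) (A : algType k) n (act : nat -> nat -> A -> A) i j a :
  (n <= j)%N -> taft_ext n act i j a = 0.
Proof. by rewrite /taft_ext ltnNge => ->. Qed.

Lemma partial_action_g (k : fieldType) (A : algType k) n (q : k)
  (act : nat -> nat -> A -> A) i i' j' a : (forall i j, linear (act i j)) ->
  is_partial_action n q act -> (i < n)%N -> (i' < n)%N -> (j' < n)%N ->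
  act i 0%N (act i' j' a) = act i 0%N 1 * taft_ext n act (i + i') j' a.
Proof.
move=> act_lin pa lt_in lt_in' lt_jn'; have n_gt0 : (0 < n)%N by case: n lt_in {pa lt_in' lt_jn'}.
have [_ _ -> //] := (partial_actionP q n_gt0 act_lin).1 pa.
by rewrite big_ord1 qbinom0r !scale1r addn0 modn_small.
Qed.

(** This is (PA.3) for the skew-primitive [g^i x], whose coproduct is
    [g^i x ⊗ g^i + g^(i+1) ⊗ g^i x]. *)
Lemma partial_action_gx (k : fieldType) (A : algType k) n (q : k)
  (act : nat -> nat -> A -> A) i i' j' a : (forall i j, linear (act i j)) ->
  is_partial_action n q act -> (1 < n)%N -> (i < n)%N -> (i' < n)%N -> (j' < n)%N ->
  act i 1%N (act i' j' a) = act i 1%N 1 * taft_ext n act (i + i') j' a +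
    act (i.+1 %% n)%N 0%N 1 * (q ^+ i' *: taft_ext n act (i + i') j'.+1 a).
Proof.
move=> act_lin pa n_gt1 lt_in lt_in' lt_jn'; have n_gt0 := ltnW n_gt1.
have [_ _ -> //] := (partial_actionP q n_gt0 act_lin).1 pa.
rewrite big_ord_recr big_ord1 /= qbinom0r qbinomnn !scale1r addn0 modn_small //.
by rewrite mul1n addn1 !add0n.
Qed.

Lemma partial_action_restrict (k : fieldType) (A : algType k) n (q : k)
  (act : nat -> nat -> A -> A) : (0 < n)%N -> (forall i j, linear (act i j)) ->
  is_partial_action n q act -> is_partial_action_group n act.
Proof.
move=> n_gt0 act_lin pa; have [pa1 pa2 _] := (partial_actionP q n_gt0 act_lin).1 pa.
apply/(partial_action_groupP n_gt0 (act_lin^~ 0%N)); split=> //.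
  by move=> i a b lt_in; rewrite pa2 // big_ord1 qbinom0r scale1r addn0 modn_small.
by move=> i l a lt_in lt_ln; rewrite (partial_action_g _ act_lin pa) // /taft_ext n_gt0.
Qed.

(* [e y = g^i . (g^-i . y)] lies in the image of the multiplicative map [g^i . _]. *)
Lemma group_unit_absorb (k : fieldType) (A : algType k) n
  (act : nat -> nat -> A -> A) i y : (forall i j, linear (act i j)) ->
  is_partial_action_group n act -> (i < n)%N ->
  act i 0%N 1 * y * act i 0%N 1 = act i 0%N 1 * y.
Proof.
move=> act_lin ga lt_in; have n_gt0 : (0 < n)%N by case: n lt_in {ga}.
have [ga1 ga2 ga3] := (partial_action_groupP n_gt0 (act_lin^~ 0%N)).1 ga.
have -> : act i 0%N 1 * y = act i 0%N (act ((n - i) %% n)%N 0%N y).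
  by rewrite ga3 ?ltn_pmod // modnDmr subnKC ?modnn ?ga1 // ltnW.
by rewrite -ga2 // mulr1.
Qed.

Lemma partial_action_global (k : fieldType) (A : algType k) n (q : k)
  (act : nat -> nat -> A -> A) : (1 < n)%N -> q != 0 -> (forall i j, linear (act i j)) ->
  is_partial_action n q act -> act 1%N 0%N 1 = 1 -> is_global_action n q act.
Proof.
move=> n_gt1 q0 act_lin pa g1; have n_gt0 := ltnW n_gt1.
split=> // h.
have [pa1 pa2 pa3] := (partial_actionP q n_gt0 act_lin).1 pa.
have act_g := partial_action_g _ act_lin pa.
have act_gx i i' j' a := @partial_action_gx _ _ _ _ _ i i' j' a act_lin pa n_gt1.
have gi1 i : (i < n)%N -> act i 0%N 1 = 1.
  elim: i => [|i IH] lt_in; first exact: pa1.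
  have lt_in' := ltnW lt_in.
  have := act_g 1%N i 0%N 1 n_gt1 lt_in' n_gt0.
  by rewrite IH // g1 mul1r add1n taft_ext_small.
(* (PA.3) for [x] against [g] reads [x.1 = x.1 + q (gx.1)]. *)
have gx1 : act 1%N 1%N 1 = 0.
  have := act_gx 0%N 1%N 0%N 1 n_gt0 n_gt1 n_gt0.
  rewrite g1 !add0n modn_small // g1 mul1r !taft_ext_small // g1 mulr1 expr1.
  move/eqP; rewrite eq_sym -subr_eq0 addrAC subrr add0r scaler_eq0 (negbTE q0).
  by move/eqP.
(* Applying [g^(n-1)] to [gx.1 = 0] recovers [x.1]. *)
have x1 : act 0%N 1%N 1 = 0.
  have := act_g n.-1 1%N 1%N 1; rewrite gx1 ?linear_at0 // gi1 ?ltn_predL // mul1r.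
  rewrite addn1 prednK // -[n in taft_ext _ _ n]addn0 taft_extDl taft_ext_small //.
  by move=> <-.
(* Since [x.1 = 0] and [g.1 = 1], (PA.3) reduces to [x.(x^j.1) = x^(j+1).1]. *)
have xj1 j : (0 < j < n)%N -> act 0%N j 1 = 0.
  elim: j => // -[//|j IH] lt_jn.
  have := act_gx 0%N 0%N j.+1 1 n_gt0 n_gt0 (ltnW lt_jn).
  rewrite IH ?(ltnW lt_jn) // linear_at0 // x1 mul0r add0r modn_small // g1 mul1r expr0 scale1r.
  by rewrite taft_ext_small.
have gixj1 i j : (i < n)%N -> (0 < j < n)%N -> act i j 1 = 0.
  move=> lt_in /andP[j_gt0 lt_jn].
  have := act_g i 0%N j 1 lt_in n_gt0 lt_jn.
  by rewrite xj1 ?j_gt0 // linear_at0 // gi1 // mul1r addn0 taft_ext_small.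
rewrite /tact /teps scaler_suml; apply: eq_bigr => i _.
case: n n_gt1 n_gt0 {pa pa1 pa2 pa3 act_g act_gx x1 xj1} gi1 gixj1 i => // n _ _ gi1 gixj1 i.
rewrite big_ord_recl gi1 // big1 ?addr0 // => j _.
by rewrite gixj1 ?scaler0 //= /bump add1n ltnS ltn_ord.
Qed.

(* The rule is (PA.3) for [g^(n-1) x] against [g^(i+1) x^j]. *)
Lemma partial_action_skew (k : fieldType) (A : algType k) n (q : k)
  (act : nat -> nat -> A -> A) a : (1 < n)%N -> n.-primitive_root q ->
  (forall i j, linear (act i j)) ->
  is_partial_action n q act -> act 1%N 0%N 1 = 0 ->
  skew_rec q (act 0%N 1%N 1) (fun i j => taft_ext n act i j a).
Proof.
move=> n_gt1 prim_q act_lin pa g1; have n_gt0 := ltnW n_gt1.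
have q0 : q != 0 by rewrite (prim_root_eq0 prim_q) -lt0n.
have [pa1 pa2 pa3] := (partial_actionP q n_gt0 act_lin).1 pa.
have act_g := partial_action_g _ act_lin pa.
have act_gx i i' j' b := @partial_action_gx _ _ _ _ _ i i' j' b act_lin pa n_gt1.
have lt_n1 : (n.-1 < n)%N by rewrite ltn_predL.
have mul_g i b : (i < n)%N -> act i 0%N b = act i 0%N 1 * act i 0%N b.
  by move=> lt_in; rewrite -[b in LHS]mul1r pa2 // big_ord1 qbinom0r scale1r addn0 modn_small.
have g_eq0 b : act 1%N 0%N b = 0 by rewrite mul_g // g1 mul0r.
(* (PA.3) gives [0 = g^(n-1).(g.1) = g^(n-1).1], and [g^(n-1).1] is a left factor of every
   [g^(n-1).b]. *)
have ginv_eq0 b : act n.-1 0%N b = 0.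
  have := act_g n.-1 1%N 0%N 1 lt_n1 n_gt1 n_gt0.
  rewrite g_eq0 linear_at0 // addn1 prednK // -[n in taft_ext _ _ n]addn0 taft_extDl.
  by rewrite taft_ext_small // pa1 mulr1 (mul_g _ b) // => <-; rewrite mul0r.
set X := act 0%N 1%N 1; set Y := act n.-1 1%N 1.
(* In (PA.2) for [g^(n-1) x] on [b * 1], the term containing [g^(n-1).1] vanishes, and the other
   group-like is [g^n = 1]. *)
have ginvx b : act n.-1 1%N b = b * Y.
  rewrite -[b in LHS]mulr1 pa2 // big_ord_recr big_ord1 /= qbinom0r qbinomnn !scale1r.
  by rewrite ginv_eq0 mulr0 add0r addn1 prednK // modnn pa1.
have rule i j b : (i < n)%N -> (j < n)%N ->
    act i j b * Y = Y * taft_ext n act (n.-1 + i) j b +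
                    q ^+ i *: taft_ext n act (n.-1 + i) j.+1 b.
  by move=> lt_in lt_jn; rewrite -ginvx act_gx // prednK // modnn pa1 mul1r.
(* [rule] for [g] acting on 1 reads [0 = Y + q X]. *)
have YE : Y = - (q *: X).
  have := rule 1%N 0%N 1 n_gt1 n_gt0.
  rewrite g_eq0 mul0r addn1 prednK // -[n in taft_ext _ _ n]addn0 !taft_extDl.
  rewrite !taft_ext_small // pa1 mulr1 expr1 => /eqP.
  by rewrite eq_sym addr_eq0 => /eqP.
move=> i j; have [le_nj|lt_jn] := leqP n j.
  by rewrite !taft_ext_large ?mulr0 ?mul0r ?subr0 ?scaler0 // ltnW.
(* The exponent [i.+1] undoes the shift by [n.-1]. The case [j = n.-1] is included: there [x^n = 0]
   makes the left side of the recursion vanish, which later yields (ii). *)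
have := rule (i.+1 %% n)%N j a; rewrite ltn_pmod // => /(_ isT lt_jn).
have ext_mod l : taft_ext n act (n.-1 + i.+1 %% n) l a = taft_ext n act i l a.
  by rewrite -taft_ext_mod modnDmr taft_ext_mod -addSnnS prednK // taft_extDl.
rewrite !ext_mod (prim_expr_mod prim_q) -/(taft_ext n act i.+1 j a).
have -> : act (i.+1 %% n)%N j a = taft_ext n act i.+1 j a by rewrite /taft_ext lt_jn.
rewrite YE mulrN mulNr -scalerAr -scalerAl exprS -scalerA => /eqP.
rewrite -subr_eq0 opprD opprK -!scalerN -!scalerDr scaler_eq0 (negbTE q0) /= => /eqP eq0.
apply: (scalerI (expf_neq0 i q0)); rewrite scalerA divff ?expf_neq0 // scale1r.
by apply/esym/eqP; rewrite -subr_eq0 -[eqbRHS]eq0 scalerN addrA [- _ + _]addrC.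
Qed.

(** * From the formula back to the axioms, and the equivalence *)

Lemma taft_formula_mod (k : fieldType) (A : algType k) n (q : k) (X : A) (E : nat -> A) i j :
  n.-primitive_root q -> (forall u, E (u %% n)%N = E u) ->
  taft_formula q X E (i %% n) j = taft_formula q X E i j.
Proof.
move=> prim_q E_mod; rewrite /taft_formula !exprM (prim_expr_mod prim_q).
by congr (_ *: _); apply: eq_bigr => m _; rewrite -E_mod modnDml E_mod.
Qed.

(** Centrality of [X ^+ n] makes the formula vanish at [x^n], and the recursion carries this zero to
    all larger exponents. Hence [taft_ext] equals the formula for every [j], beyond the truncation
    too. *)
Lemma taft_ext_skew (k : fieldType) (A : algType k) n (q : k) (X : A)
  (act : nat -> nat -> A -> A) a : (1 < n)%N -> n.-primitive_root q ->
  (forall i j, (i < n)%N -> (j < n)%N ->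
    act i j a = taft_formula q X (fun u => act (u %% n)%N 0%N a) i j) ->
  (forall b : A, X ^+ n * b = b * X ^+ n) ->
  skew_rec q X (fun i j => taft_ext n act i j a).
Proof.
move=> n_gt1 prim_q act_formula Xn_central; have n_gt0 := ltnW n_gt1.
have q0 : q != 0 by rewrite (prim_root_eq0 prim_q) -lt0n.
pose E u := act (u %% n)%N 0%N a.
have F_skew := taft_formula_skew X E q0.
have F_large i d : taft_formula q X E i (n + d) = 0.
  elim: d i => [|d IH] i; last by rewrite addnS F_skew !IH mulr0 mul0r subr0 scaler0.
  by rewrite addn0 taft_formula_prim // /E modnDr Xn_central subrr.
suff extE i j : taft_ext n act i j a = taft_formula q X E i j.
  by move=> i j; rewrite !extE.
have [le_nj|lt_jn] := leqP n j; first by rewrite taft_ext_large // -(subnKC le_nj) F_large.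
rewrite -taft_ext_mod taft_ext_small ?ltn_pmod // act_formula ?ltn_pmod //.
by rewrite taft_formula_mod // => u; rewrite /E modn_mod.
Qed.

Lemma partial_action_of_formula (k : fieldType) (A : algType k) n (q : k)
  (act : nat -> nat -> A -> A) : (1 < n)%N -> n.-primitive_root q ->
  (forall i j, linear (act i j)) ->
  is_partial_action_group n act ->
  (forall a, skew_rec q (act 0%N 1%N 1) (fun i j => taft_ext n act i j a)) ->
  (forall i, (i < n)%N ->
    act i 0%N (act 0%N 1%N 1) = q ^- i *: (act i 0%N 1 * act 0%N 1%N 1)) ->
  is_partial_action n q act.
Proof.
move=> n_gt1 prim_q act_lin ga ext_skew gX; have n_gt0 := ltnW n_gt1.
have q0 : q != 0 by rewrite (prim_root_eq0 prim_q) -lt0n.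
have [ga1 ga2 ga3] := (partial_action_groupP n_gt0 (act_lin^~ 0%N)).1 ga.
set X := act 0%N 1%N 1 in ext_skew gX.
have act_ext i j a : (j < n)%N -> act (i %% n)%N j a = taft_ext n act i j a.
  by rewrite /taft_ext => ->.
have act_ext0 i a : (i < n)%N -> taft_ext n act i 0%N a = act i 0%N a.
  by move=> lt_in; rewrite taft_ext_small.
(* This is (PA.3) for the group-like [g^i], by induction on the exponent of [x] in the second
   argument. *)
have g_ext i i' j a : (i < n)%N ->
    act i 0%N (taft_ext n act i' j a) = act i 0%N 1 * taft_ext n act (i + i') j a.
  move=> lt_in; elim: j i' => [|j IH] i'.
    by rewrite /taft_ext n_gt0 ga3 ?ltn_pmod // modnDmr.
  rewrite !ext_skew.
  have act_sub b c d : act i 0%N (d *: (b - c)) = d *: (act i 0%N b - act i 0%N c).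
    rewrite -[d *: (b - c)]addr0 act_lin linear_at0 // addr0.
    by rewrite [b - c]addrC -scaleN1r act_lin scaleN1r addrC.
  (* With [e = g^i.1], the hypothesis on [g^i.X] brings in [e X], and [e y e = e y] removes the
     inner copy of [e] from each product. *)
  rewrite act_sub !ga2 // !IH gX // -!scalerAl -!scalerAr -scalerBr scalerA.
  rewrite !mulrA !(group_unit_absorb _ act_lin ga) //.
  by rewrite mulrBr !mulrA addnS exprD invfM [q ^- i * _]mulrC.
apply/(partial_actionP q n_gt0 act_lin); split=> //.
  move=> i j a b lt_in lt_jn; rewrite -[LHS](taft_ext_small act _ lt_in lt_jn).
  rewrite (skew_rec_mul q0 (ext_skew _) (ext_skew a) (ext_skew b)) => [|u].
    apply: eq_bigr => m _; have lt_mn := leq_trans (ltn_ord m) lt_jn.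
    by rewrite act_ext ?(leq_ltn_trans (leq_subr _ _)) // (taft_ext_small act b lt_in lt_mn).
  by rewrite /taft_ext n_gt0 ga2 // ltn_pmod.
move=> i j i' j' a lt_in lt_jn lt_in' lt_jn'; rewrite -[LHS](taft_ext_small act _ lt_in lt_jn).
(* [D2] is [h] acting through [h k] on [a], with [k = g^i' x^j']; the power of [q] comes from moving
   [x^m] past [g^i']. *)
pose D2 i m : A := q ^+ (m * i') *: taft_ext n act (i + i') (m + j') a.
have D2_skew : skew_rec q X D2.
  move=> u m; rewrite /D2 addSn ext_skew -scalerAr -scalerAl -scalerBr !scalerA.
  by congr (_ *: _); rewrite mulSn !exprD; field; rewrite !expf_neq0.
rewrite (skew_rec_mul q0 (ext_skew _) (ext_skew 1) D2_skew) => [|u].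
  apply: eq_bigr => m _.
  by rewrite act_ext ?(leq_ltn_trans (leq_subr _ _)).
(* The remaining initial condition at [x^0] is the group-like case [g_ext]. *)
rewrite /D2 mul0n scale1r add0n -taft_ext_mod -[taft_ext n act u 0 1]taft_ext_mod.
rewrite !act_ext0 ?ltn_pmod // -(taft_ext_small act a lt_in' lt_jn') g_ext ?ltn_pmod //.
by rewrite -taft_ext_mod modnDml taft_ext_mod.
Qed.

Theorem theorem3p9 (k : fieldType) (n : nat) (q : k) (A : algType k)
  (act : nat -> nat -> A -> A) :
  (2 <= n)%N ->
  n.-primitive_root q ->
  (forall i j : nat, linear (act i j)) ->
  (act 1%N 0%N 1 = 0 \/ act 1%N 0%N 1 = 1) ->
  (is_partial_action n q act <->
   (is_global_action n q act \/
    [/\ is_partial_action_group n act,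
        act 1%N 0%N 1 = 0,
        (* (i) *)
        (forall (i j : nat) (a : A), (i < n)%N -> (j < n)%N ->
          act i j a =
          q ^- (i * j) *:
            \sum_(m < j.+1)
              ((-1) ^+ m * q ^- (m * (m - 1) %/ 2) * qbinom q^-1 j m) *:
                (act 0%N 1%N 1 ^+ (j - m) * act ((i + m) %% n)%N 0%N a
                 * act 0%N 1%N 1 ^+ m)),
        (* (ii) (x.1)^n is central *)
        (forall b : A, act 0%N 1%N 1 ^+ n * b = b * act 0%N 1%N 1 ^+ n) &
        (* (iii) *)
        (forall i : nat, (i < n)%N ->
          act i 0%N (act 0%N 1%N 1) = q ^- i *: (act i 0%N 1 * act 0%N 1%N 1))])).
Proof.
move=> n_gt1 prim_q act_lin g1; have n_gt0 := ltnW n_gt1.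
have q0 : q != 0 by rewrite (prim_root_eq0 prim_q) -lt0n.
split=> [pa|[[]//|[ga _ act_formula Xn_central gX]]]; last first.
  apply: partial_action_of_formula => // a.
  by apply: taft_ext_skew => // i j lt_in lt_jn; exact: act_formula.
case: g1 => g1; [right | by left; apply: partial_action_global].
have ga := partial_action_restrict n_gt0 act_lin pa.
have [ga1 ga2 ga3] := (partial_action_groupP n_gt0 (act_lin^~ 0%N)).1 ga.
set X := act 0%N 1%N 1.
have ext_skew a : skew_rec q X (fun i j => taft_ext n act i j a).
  exact: partial_action_skew.
have ext_formula a i j :
    taft_ext n act i j a = taft_formula q X (fun u => act (u %% n)%N 0%N a) i j.
  rewrite (skew_rec_formula q0 (ext_skew a)); congr (_ *: _).
  by apply: eq_bigr => m _; rewrite /taft_ext n_gt0.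
split=> //.
- by move=> i j a lt_in lt_jn; rewrite -[LHS](taft_ext_small act _ lt_in lt_jn) ext_formula.
(* At [x^n] the action is 0, whereas the formula gives [X^n b - b X^n]. *)
- move=> b; have := ext_formula b 0%N n.
  rewrite taft_ext_large // taft_formula_prim // add0n modnn mod0n ga1 => /eqP.
  by rewrite eq_sym subr_eq0 => /eqP.
- move=> i lt_in.
  (* With [e = g^i.1], (PA.3) gives [e (g^i x.1)], and the recursion expands the second factor. Then
     [e X e = e X], while [e (g^(i+1).1) = g^i.(g.1) = 0]. *)
  rewrite /X (partial_action_g _ act_lin pa) // addn0 (ext_skew 1) -scalerAr; congr (_ *: _).
  rewrite mulrBr !mulrA {1 2}/taft_ext !n_gt0 modn_small //.
  rewrite (group_unit_absorb _ act_lin ga) // -[i.+1]addn1 -ga3 // g1 linear_at0 //.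
  by rewrite mul0r subr0.
Qed.
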